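(* Let $G=(V,\mathcal D,\mathcal B)$ be an acyclic directed mixed graph with Gaussian linear structural equation model $X_V\sim N(0,\Sigma)$, let $a^*\to b\in\mathcal D$, and suppose that $\lambda_{a^*b}$ and $\sigma(\mathcal D_{bc})$ are identifiable for all $c\in\operatorname{de}(b)\setminus\{b\}$. Then removing the directed edge $a^*\to b$ is equivalent to replacing $X_V$ by $$X_V^*=X_V-\lambda_{a^*b}\,\Sigma(\mathcal D_{bV})\,X_{a^*}.$$ That is, the vector $X_V^*$ so defined is the solution, with the same error vector $\epsilon$, of the structural equations in which $\lambda_{a^*b}$ is replaced by $0$; in particular $X_V^*\sim N(0,\Sigma^* )$, where $\Sigma^*$ is the covariance matrix after removal of $a^*\to b$.
   Context: An acyclic directed mixed graph (ADMG) $G=(V,\mathcal D,\mathcal B)$ has a finite vertex set $V$, a set $\mathcal D$ of directed edges and a set $\mathcal B$ of bidirected edges, with no loops and no directed cycles. The parameter space $\Theta$ consists of pairs $(\Lambda,\Omega)$ where $\Lambda=(\lambda_{ij})\in\mathbb R^{V\times V}$ has $\lambda_{ij}=0$ unless $i\to j\in\mathcal D$, and $\Omega$ is symmetric positive definite with $\omega_{ij}=0$ unless $i=j$ or $i\leftrightarrow j\in\mathcal B$. The linear structural equation model is $X=\Lambda^TX+\epsilon$ with $\epsilon\sim N(0,\Omega)$, so $X=(I-\Lambda)^{-T}\epsilon$ and $\Sigma=\phi(\Lambda,\Omega)=(I-\Lambda)^{-T}\Omega(I-\Lambda)^{-1}$. Removing the edge $a^*\to b$ replaces $\Lambda$ by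 $\Lambda^*$, equal to $\Lambda$ except that the entry $\lambda_{a^*b}$ is set to $0$, with the error terms kept the same (''stable error terms''); $\Sigma^*=(I-\Lambda^* )^{-T}\Omega(I-\Lambda^* )^{-1}$. $\operatorname{de}(v)$ is the set of descendants of $v$, including $v$. $\mathcal D_{uv}$ is the set of directed paths from $u$ to $v$ in $G$, and $\sigma(\mathcal D_{uv})=\sum_{\tau\in\mathcal D_{uv}}\prod_{x\to y\in\tau}\lambda_{xy}$, with $\sigma(\mathcal D_{bb})=1$ and $\sigma(\mathcal D_{bv})=0$ if $v\notin\operatorname{de}(b)$. $\Sigma(\mathcal D_{bV})=(\sigma(\mathcal D_{bv}))_{v\in V}$ is a vector indexed by $V$. A function $f$ on $\Theta$ is identifiable if for Lebesgue-almost all $\theta\in\Theta$ it is constant on the fibre $\phi^{-1}(\phi(\theta))$. *)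

(* Defs.v *)
From HB Require Import structures.
From mathcomp Require Import all_boot all_order all_algebra.
From mathcomp Require Import all_classical all_reals all_analysis.

Set Implicit Arguments.
Unset Strict Implicit.
Unset Printing Implicit Defensive.
Import Order.TTheory GRing.Theory Num.Theory.
Import numFieldNormedType.Exports.
Local Open Scope classical_set_scope.
Local Open Scope ring_scope.

(* Taking c := [:: x] in [dir_acyclic] also excludes directed loops. *)
Record admg (n : nat) := Admg {
  dir : rel 'I_n;
  bidir : rel 'I_n;
  dir_acyclic : forall c : seq 'I_n, cycle dir c -> c = [::];
  bidir_sym : symmetric bidir;
  bidir_irr : irreflexive bidir }.

Definition de n (G : admg n) (v : 'I_n) : {set 'I_n} :=
  [set w | connect (dir G) v w]%SET.

(* A directed path is its start u together with the sequence p of its further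
   vertices; p = [::] is the trivial path. *)
Definition dpath n (G : admg n) (u v : 'I_n) (p : seq 'I_n) : bool :=
  [&& path (dir G) u p, last u p == v & uniq (u :: p)].

(* The vertices of a path are distinct, so sequences of size at most n exhaust
   all directed paths; [zip (u :: p) p] lists the edges of the path. *)
Definition path_sum (R : realType) n (G : admg n) (L : 'M[R]_n)
    (u v : 'I_n) : R :=
  \sum_(p : n.-bseq 'I_n | dpath G u v p)
    \prod_(e <- zip (u :: p) p) L e.1 e.2.

Definition path_sum_vec (R : realType) n (G : admg n) (L : 'M[R]_n)
    (u : 'I_n) : 'cV[R]_n :=
  \col_v path_sum G L u v.

Definition pos_def (R : realType) n (S : 'M[R]_n) : Prop :=
  S^T = S /\ forall x : 'cV[R]_n, x != 0 -> 0 < (x^T *m S *m x) 0 0.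

Definition Theta (R : realType) n (G : admg n) : set ('M[R]_n * 'M[R]_n) :=
  [set th : 'M[R]_n * 'M[R]_n | [/\ forall i j, ~~ dir G i j -> th.1 i j = 0,
                pos_def th.2 &
                forall i j, i != j -> ~~ bidir G i j -> th.2 i j = 0]].

Definition phi (R : realType) n (th : 'M[R]_n * 'M[R]_n) : 'M[R]_n :=
  (invmx (1%:M - th.1))^T *m th.2 *m invmx (1%:M - th.1).

(* Lebesgue-null subsets of R^I: for every e > 0 there is a countable cover by
   boxes of total volume at most e (I is nonempty where this is used). *)
Definition lebesgue_null (R : realType) (I : finType) (A : set (I -> R)) :=
  forall e : R, 0 < e -> exists l u : nat -> I -> R,
    [/\ forall k i, l k i <= u k i,
        A `<=` \bigcup_k [set x | forall i, l k i <= x i <= u k i] &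
        (\sum_(k <oo) (\prod_i (u k i - l k i))%:E <= e%:E)%E].

(* Free coordinates of Theta: one per directed edge, one per vertex (diagonal
   of Omega) and one per bidirected edge, taken once with its smaller endpoint
   first. Lebesgue measure on Theta refers to these coordinates. *)
Definition coord_index n (G : admg n) : finType :=
  ({e : 'I_n * 'I_n | dir G e.1 e.2} +
   {e : 'I_n * 'I_n |
     (e.1 == e.2) || (bidir G e.1 e.2 && (e.1 < e.2)%N)})%type.

Definition coords (R : realType) n (G : admg n) (th : 'M[R]_n * 'M[R]_n) :
    coord_index G -> R :=
  fun k => match k with
           | inl e => th.1 (val e).1 (val e).2
           | inr e => th.2 (val e).1 (val e).2
           end.

Definition identifiable (R : realType) n (G : admg n)
    (f : 'M[R]_n * 'M[R]_n -> R) : Prop :=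
  lebesgue_null (@coords R n G @`
    [set th : 'M[R]_n * 'M[R]_n | Theta G th /\
       ~ (forall th', Theta G th' -> phi th' = phi th -> f th' = f th)]).

(* The univariate normal law with mean 0 and variance v >= 0. The library's
   [normal_prob] is not the point mass when its standard deviation is 0. *)
Definition normal_law (R : realType) (v : R) (A : set R) : \bar R :=
  if v == 0 then \d_(0 : R) A else normal_prob 0 (Num.sqrt v) A.

(* X ~ N(0, S): every linear combination c^T X is N(0, c^T S c). *)
Definition gaussian (R : realType) (d : measure_display)
    (T : measurableType d) (P : probability T R) n
    (X : T -> 'cV[R]_n) (S : 'M[R]_n) : Prop :=
  (forall i, measurable_fun setT (fun w => X w i 0)) /\
  forall (c : 'cV[R]_n) (A : set R), measurable A ->
    P ((fun w => (c^T *m X w) 0 0) @^-1` A)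
      = normal_law ((c^T *m S *m c) 0 0) A.

Definition solves_sem (R : realType) (T : Type) n (L : 'M[R]_n)
    (eps X : T -> 'cV[R]_n) : Prop :=
  forall w, X w = L^T *m X w + eps w.

Definition remove_coef (R : realType) n (L : 'M[R]_n) (a b : 'I_n) : 'M[R]_n :=
  \matrix_(i, j) if (i == a) && (j == b) then 0 else L i j.

Definition X_removed (R : realType) (T : Type) n (G : admg n) (L : 'M[R]_n)
    (a b : 'I_n) (X : T -> 'cV[R]_n) : T -> 'cV[R]_n :=
  fun w => X w - (L a b * X w a 0) *: path_sum_vec G L b.

(* Main.v *)
(* Write pi for the vector of path sums out of b. Splitting off the last edge
   of a path gives pi = e_b + L^T pi, and acyclicity with a -> b gives
   pi_a = 0. Hence X_a is unchanged by the replacement, and substituting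
   X - lambda_ab X_a pi into the equations without the edge a -> b is a direct
   computation. Uniqueness and the Gaussian law follow from the invertibility
   of I - L for every L supported on an acyclic graph. *)
Require Import Defs.
From HB Require Import structures.
From mathcomp Require Import all_boot all_order all_algebra.
From mathcomp Require Import all_classical all_reals all_analysis.
From mathcomp Require Import measurable_realfun.
Import Order.TTheory GRing.Theory Num.Theory.
Import numFieldNormedType.Exports.
Local Open Scope ring_scope.

Lemma path_no_back {n : nat} {G : admg n} {u : 'I_n} {p : seq 'I_n} :
  path (dir G) u p -> ~~ dir G (last u p) u.
Proof.
move=> up; apply/negP => back.
by have := @dir_acyclic _ G (u :: p); rewrite /= rcons_path up back => /(_ isT).
Qed.

Lemma connect_no_back {n : nat} {G : admg n} {u v : 'I_n} :
  connect (dir G) u v -> ~~ dir G v u.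
Proof. by case/connectP => p up ->; apply: path_no_back. Qed.

(** If the start occurred again, the initial segment up to that occurrence would close a directed
    cycle. Hence the [uniq] clause in [dpath] is automatic. *)
Lemma path_uniq {n : nat} {G : admg n} {u : 'I_n} {p : seq 'I_n} :
  path (dir G) u p -> uniq (u :: p).
Proof.
elim: p u => // v p IHp u up; have /andP[_ vp] := up.
rewrite cons_uniq (IHp _ vp) andbT; apply/negP => u_in.
case/splitPr: u_in up => p1 p2; rewrite cat_path /= => /and3P[up1 back _].
by have := path_no_back up1; rewrite back.
Qed.

Lemma dpathE {n : nat} (G : admg n) (u v : 'I_n) (p : seq 'I_n) :
  dpath G u v p = path (dir G) u p && (last u p == v).
Proof.
rewrite /dpath; case up: (path _ u p) => //=.
by have /= -> := path_uniq up; rewrite andbT.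
Qed.

Lemma big_zip_rcons {R : Type} {idx : R} (op : Monoid.law idx) {S : Type}
    (u v : S) (q : seq S) (F : S * S -> R) :
  \big[op/idx]_(e <- zip (u :: rcons q v) (rcons q v)) F e =
  op (\big[op/idx]_(e <- zip (u :: q) q) F e) (F (last u q, v)).
Proof.
elim: q u => [|x q IHq] u.
  by rewrite /= big_seq1 big_nil Monoid.mul1m.
by have /= IH := IHq x; rewrite /= !big_cons IH Monoid.mulmA.
Qed.

Section PathSum.
Context {R : realType} {n : nat} {G : admg n} {L : 'M[R]_n}.

Lemma path_sum_not_connected {u v : 'I_n} :
  ~~ connect (dir G) u v -> path_sum G L u v = 0.
Proof.
move=> nuv; rewrite /path_sum big_pred0 // => p.
apply: contraNF nuv; rewrite dpathE => /andP[up /eqP <-].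
by apply/connectP; exists p.
Qed.

Lemma path_sum_refl (u : 'I_n) : path_sum G L u u = 1.
Proof.
rewrite /path_sum (big_pred1 [bseq]) ?big_nil // => p.
rewrite [RHS]/= -(inj_eq val_inj) /=; case: p => -[|x p] /= _; first by rewrite /dpath /= eqxx.
rewrite /dpath; apply/negbTE/negP => /and3P[_ /eqP /= e].
by rewrite -[in X in ~~ X]e mem_last.
Qed.

Hypothesis Lsupp : forall i j, ~~ dir G i j -> L i j = 0.

(** Since [u != v], every path to [v] is nontrivial and so arises from exactly one path [q] by
    appending an edge [last u q -> v]; the edge contributes the factor [L (last u q) v]. *)
Lemma path_sum_last_edge {u v : 'I_n} : u != v ->
  path_sum G L u v = \sum_x L x v * path_sum G L u x.
Proof.
move=> uv; pose ext (q : n.-bseq 'I_n) := insub_bseq n (rcons q v).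
pose cut (p : n.-bseq 'I_n) := insub_bseq n (take (size p).-1 p).
have cutE (p : n.-bseq 'I_n) : cut p = take (size p).-1 p :> seq _.
  rewrite /cut /insub_bseq val_insubd ifT // size_take_min.
  by rewrite (leq_trans (geq_minr _ _)) ?size_bseq.
have extE (q : n.-bseq 'I_n) :
    (size q < n)%N -> ext q = rcons q v :> seq _.
  by move=> qn; rewrite /ext /insub_bseq val_insubd size_rcons qn.
(* When [q] already has length [n], the extension does not fit the bound and [insub_bseq] falls back
   to the empty sequence. *)
have ext_nil (q : n.-bseq 'I_n) :
    (size q < n)%N = false -> ext q = [::] :> seq _.
  by move=> qn; rewrite /ext /insub_bseq val_insubd size_rcons qn.
rewrite /path_sum.
under [RHS]eq_bigr => x _ do rewrite big_distrr /= big_mkcond.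
rewrite exchange_big /=.
(* For fixed [q] only [x = last u q] survives in the inner sum, and a missing edge to [v] makes its
   coefficient zero by [Lsupp]. *)
transitivity (\sum_(q : n.-bseq 'I_n |
    path (dir G) u q && dir G (last u q) v)
    L (last u q) v * \prod_(e <- zip (u :: q) q) L e.1 e.2); last first.
  rewrite big_mkcond; apply: eq_bigr => q _.
  rewrite (bigD1 (last u q)) //= [X in _ + X]big1 => [|x xq]; last first.
    by rewrite dpathE eq_sym (negbTE xq) andbF.
  rewrite addr0 dpathE eqxx andbT; case: (path _ u q) => //=.
  by case: ifPn => // /Lsupp ->; rewrite mul0r.
rewrite (reindex_onto ext cut) /=; last first.
  move=> p; rewrite dpathE => /andP[_ /eqP lastp]; apply: val_inj => /=.
  move: lastp (cutE p) (size_bseq p); move: (cut p) => c.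
  case/lastP: (bseqval p) => [|q x] /=.
    by move=> uv'; rewrite uv' eqxx in uv.
  rewrite last_rcons size_rcons => -> cE qn.
  have {}cE : c = q :> seq _ by rewrite cE /= -cats1 take_size_cat.
  by rewrite extE cE.
apply: eq_big => [q|q /andP[dp _]]; last first.
  (* The fallback value [[::]] is the trivial path at [u], which does not end at [v], so a [q] of
     full length is excluded. *)
  case qn: (size q < n)%N; last first.
    by move: dp; rewrite (ext_nil _ qn) dpathE /= (negbTE uv).
  by rewrite (extE _ qn) big_zip_rcons mulrC.
apply/idP/idP => [/andP[dp _]|/andP[uq qv]].
  case qn: (size q < n)%N; last first.
    by move: dp; rewrite (ext_nil _ qn) dpathE /= (negbTE uv).
  by move: dp; rewrite (extE _ qn) dpathE rcons_path => /andP[].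
have uqv : path (dir G) u (rcons q v) by rewrite rcons_path uq.
(* The [size q + 2] vertices of the extended path are distinct elements of ['I_n], so the extension
   always fits. *)
have qn : (size q < n)%N.
  have := path_uniq uqv => /card_uniqP card.
  have := max_card (mem (u :: rcons q v)).
  by rewrite card card_ord /= size_rcons; apply: ltnW.
rewrite (extE _ qn) dpathE uqv last_rcons eqxx /=; apply/eqP/val_inj.
by rewrite /= cutE (extE _ qn) size_rcons /= -cats1 take_size_cat.
Qed.

Lemma path_sum_vec_rec (u : 'I_n) :
  path_sum_vec G L u = delta_mx u 0 + L^T *m path_sum_vec G L u.
Proof.
apply/colP => v; rewrite !mxE eqxx andbT eq_sym.
under eq_bigr => x _ do rewrite !mxE.
case: (eqVneq u v) => [<-|uv] /=; last by rewrite add0r path_sum_last_edge.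
(* In coordinate [u] every term vanishes: if [x] is reachable from [u], an edge [x -> u] would close
   a cycle; otherwise no path leads from [u] to [x]. *)
rewrite path_sum_refl big1 ?addr0 // => x _.
have [/connect_no_back/Lsupp ->|] := boolP (connect (dir G) u x).
  by rewrite mul0r.
by move/path_sum_not_connected ->; rewrite mulr0.
Qed.

(** A row vector [v] in the kernel satisfies [v = v *m L], so its entry at [j] is a combination of
    its entries at the parents of [j]. Induction on the number of ancestors makes all of them
    zero. *)
Lemma unitmx_one_sub_acyclic : 1%:M - L \in unitmx.
Proof.
rewrite -row_free_unit; apply: inj_row_free => v.
rewrite mulmxBr mulmx1 => /eqP; rewrite subr_eq0 => /eqP vE.
apply/rowP => j; rewrite mxE.
have [m] := ubnP #|[set x | connect (dir G) x j]%SET|.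
elim: m j => // m IHm j jm; rewrite vE mxE big1 // => x _.
have [xj|/Lsupp ->] := boolP (dir G x j); last by rewrite mulr0.
rewrite IHm ?mul0r //; rewrite ltnS in jm.
apply: leq_trans jm; apply: proper_card.
apply/properP; split.
  (* Ancestors of a parent [x] are ancestors of [j], while [j] itself is not an ancestor of [x]. *)
  apply/fintype.subsetP => y; rewrite !inE => yx.
  exact: connect_trans yx (connect1 xj).
exists j; rewrite inE ?connect0 //.
by apply/negP => /connect_no_back; rewrite xj.
Qed.

End PathSum.

Lemma solves_semE {R : realType} {T : Type} {n : nat} {L : 'M[R]_n}
    {eps X : T -> 'cV[R]_n} : 1%:M - L \in unitmx ->
  solves_sem L eps X <-> forall w, X w = (invmx (1%:M - L))^T *m eps w.
Proof.
move=> uL; have uLT : (1%:M - L)^T \in unitmx by rewrite unitmx_tr.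
have LT (x : 'cV[R]_n) : (1%:M - L)^T *m x = x - L^T *m x.
  by rewrite linearB /= trmx1 mulmxBl mul1mx.
rewrite trmx_inv; split=> [sol w|XE w].
  have -> : eps w = (1%:M - L)^T *m X w by rewrite LT {1}sol addrAC subrr add0r.
  by rewrite mulKmx.
have : (1%:M - L)^T *m X w = eps w by rewrite XE mulKVmx.
by rewrite LT => <-; rewrite addrC subrK.
Qed.

(** A linear combination of [A *m X] with coefficients [c] is one of [X] with coefficients
    [A^T *m c]. *)
Lemma gaussian_mulmx {R : realType} {d : measure_display}
    {T : measurableType d} (P : probability T R) {n : nat}
    (A : 'M[R]_n) (X : T -> 'cV[R]_n) (S : 'M[R]_n) :
  gaussian P X S -> gaussian P (fun w => A *m X w) (A *m S *m A^T).
Proof.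
move=> [mX lawX]; split=> [i|c B mB].
  under eq_fun do rewrite mxE.
  by apply: measurable_sum => j; exact: measurable_funM (measurable_cst _) (mX j).
have := lawX (A^T *m c) B mB.
by rewrite trmx_mul trmxK !mulmxA; under eq_fun do rewrite -mulmxA.
Qed.

Lemma remove_coefE {R : realType} {n : nat} (L : 'M[R]_n) (a b : 'I_n) :
  remove_coef L a b = L - L a b *: delta_mx a b.
Proof.
apply/matrixP => i j; rewrite !mxE.
by case: ifPn => [/andP[/eqP -> /eqP ->]|_]; rewrite ?mulr1 ?subrr ?mulr0 ?subr0.
Qed.

Theorem theorem3p9 (R : realType) (n : nat) (G : admg n) (a b : 'I_n)
    (hab : dir G a b)
    (hlambda : identifiable G (fun th : 'M[R]_n * 'M[R]_n => th.1 a b))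
    (hsigma : forall c : 'I_n, c \in (de G b :\ b)%SET ->
       identifiable G (fun th : 'M[R]_n * 'M[R]_n => path_sum G th.1 b c))
    (L Omega : 'M[R]_n) (hTheta : Theta G (L, Omega))
    (d : measure_display) (T : measurableType d) (P : probability T R)
    (eps X : T -> 'cV[R]_n)
    (heps : gaussian P eps Omega) (hX : solves_sem L eps X) :
  [/\ solves_sem (remove_coef L a b) eps (X_removed G L a b X),
      forall Y : T -> 'cV[R]_n, solves_sem (remove_coef L a b) eps Y ->
        Y = X_removed G L a b X &
      gaussian P (X_removed G L a b X) (phi (remove_coef L a b, Omega))].
Proof.
have [/= Lsupp _ _] := hTheta.
have L'supp i j : ~~ dir G i j -> remove_coef L a b i j = 0.
  by rewrite mxE => /Lsupp ->; rewrite if_same.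
have L'unit := unitmx_one_sub_acyclic L'supp.
have pi_a : path_sum G L b a = 0.
  by apply: path_sum_not_connected; apply/negP => /connect_no_back; rewrite hab.
have sol : solves_sem (remove_coef L a b) eps (X_removed G L a b X).
  move=> w; rewrite /X_removed; set pi := path_sum_vec G L b.
  set k := L a b * X w a 0.
  have L'T (x : 'cV[R]_n) : (remove_coef L a b)^T *m x =
      L^T *m x - (L a b * x a 0) *: delta_mx b 0.
    rewrite remove_coefE linearB linearZ /= trmx_delta mulmxBl -scalemxAl.
    congr (_ - _); rewrite -scalerA; congr (_ *: _).
    apply/colP => i; rewrite !mxE (bigD1 a) //= big1 => [|j ja].
      by rewrite !mxE !eqxx !andbT addr0 mulrC.
    by rewrite mxE (negbTE ja) andbF mul0r.
  have X'a : (X w - k *: pi) a 0 = X w a 0.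
    by rewrite !mxE pi_a mulr0 subr0.
  (* Expanding [X w] by its equation and [pi] by its recursion, both sides become
     [L^T X + eps - k L^T pi - k e_b]: the deleted edge accounts for [k e_b] on the right, the start
     of the recursion on the left. *)
  rewrite L'T X'a mulmxBr -scalemxAr -/k {1}hX.
  rewrite {1}[pi]path_sum_vec_rec // -/pi scalerDr opprD !addrA.
  rewrite [LHS]addrAC [in RHS]addrAC -!addrA; congr (_ + _).
  by rewrite addrCA.
have solE := (solves_semE L'unit).1 sol.
split=> [|Y /(solves_semE L'unit) YE|]; first exact: sol.
  by apply: funext => w; rewrite YE solE.
rewrite (funext solE).
have := gaussian_mulmx P (invmx (1%:M - remove_coef L a b))^T _ _ heps.
by rewrite trmxK.
Qed.
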